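(* The interpretability logic $\mathsf{ILM}$ is complete for finitary provability models over $\mathcal L_\rhd$: if $A\in\mathcal L_\rhd$ holds at every world of every finitary provability model, then $\mathsf{ILM}\vdash A$.
   Context: Language $\mathcal L_\rhd$: formulas built from atomic propositions and $\bot$ using $\to$ and a binary $\rhd$; $\neg A:=A\to\bot$, Boolean connectives defined classically, $\Box A:=\neg A\rhd\bot$, $\Diamond A:=\neg\Box\neg A$. Purely modal: Boolean combination of formulas $B\rhd C$. $\mathsf{ILM}$: the logic in $\mathcal L_\rhd$ with modus ponens as only rule and axioms: all theorems of $\mathsf{GL}$ ($\mathsf K$ plus $\Box A\to\Box\Box A$ and $\Box(\Box A\to A)\to\Box A$, over $\mathcal L_\rhd$); $\Box(A\to B)\to A\rhd B$; $(A\rhd B\wedge B\rhd C)\to A\rhd C$; $(B\rhd A\wedge C\rhd A)\to(B\vee C)\rhd A$; $\Diamond A\rhd A$; $A\rhd B\to((\Box C\wedge A)\rhd(\Box C\wedge B))$; and $\Box X$ for $X$ an instance of the previous five schemes. A theory is a pair of a set of axioms and a set of inference rules over $\mathcal L_\rhd$; $\mathsf T\vdash A$ means derivability; classical: modus ponens is a rule and all classical tautologies are derivable. A provability pre-model is $\mathcal P=(W,\sqsubset,\{L_w\}_{w\in W^\sqsubset},V)$ with $W$ nonempty, $\sqsubset$ a binary relation, $V\subseteq W\times\mathrm{atoms}$, $W^\sqsubset=\{u:\exists v\,(v\sqsubset u)\}$, and a theory $L_w$ for each $w\in W^\sqsubset$. Satisfaction: atoms via $V$, $\bot$ never holds, $\to$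 classical, $\mathcal P,w\Vdash A\rhd B$ iff for every $u$ with $w\sqsubset u$ and every $E$, $L_u\vdash B\to\Diamond E$ implies $L_u\vdash A\to\Diamond E$. With $\sqsubset^+$ the transitive closure, $\mathcal P,w\Vdash^+A$ iff there is $u\sqsubset w$ with $\mathcal P,v\Vdash A$ for all $v$ with $u\sqsubset^+v$. A provability model is a pre-model with all $L_w$ classical and modal completeness: for $w\in W^\sqsubset$ and purely modal $A$, $\mathcal P,w\Vdash^+A$ implies $L_w\vdash A$. Necessitation: every $L_w$ has the rule ''from $A$ infer $\Box A$''. $\mathcal P\subseteq\mathcal P'$: same $W,\sqsubset,V$ and every theorem of $L_w$ is a theorem of $L'_w$. Bi-finite: $W$ finite and each $L_w$ has finitely many axioms and no rules. Tree: whenever $w\sqsubset v$ and $u\sqsubset v$, either $w=u$, $w\sqsubset^+u$ or $u\sqsubset^+w$; converse well-founded: no infinite chain $w_0\sqsubset w_1\sqsubset\cdots$. For a converse well-founded tree pre-model $\mathcal P$ there is a $\subseteq$-minimal provability model with necessitation containing $\mathcal P$ (unique up to same frame, valuation and sets of theorems), called the model generated by $\mathcal P$. A provability model is finitary if it is generated by a bi-finite converse well-founded tree pre-model. *)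

(* Defs.v *)
From Stdlib Require Import List Relations FinFun.
Import ListNotations.

Inductive form : Type :=
| Atom (p : nat)
| Bot
| Imp (A B : form)
| Rhd (A B : form).

Definition Neg (A : form) : form := Imp A Bot.
Definition Or (A B : form) : form := Imp (Neg A) B.
Definition And (A B : form) : form := Neg (Imp A (Neg B)).
Definition Box (A : form) : form := Rhd (Neg A) Bot.
Definition Dia (A : form) : form := Neg (Box (Neg A)).

(* [s] assigns truth values to the propositionally indecomposable formulas,
   that is, atoms and formulas [Rhd B C]; its other values are not used. *)
Fixpoint beval (s : form -> bool) (A : form) : bool :=
  match A with
  | Bot => false
  | Imp B C => implb (beval s B) (beval s C)
  | Atom _ | Rhd _ _ => s A
  end.

Definition tautology (A : form) : Prop := forall s, beval s A = true.

Inductive purely_modal : form -> Prop :=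
| pm_bot : purely_modal Bot
| pm_imp A B : purely_modal A -> purely_modal B -> purely_modal (Imp A B)
| pm_rhd A B : purely_modal (Rhd A B).

(* Inference rules are given by their instances: [rules T ps A] says that [A]
   may be inferred in [T] from the finite list of premises [ps]. *)
Record theory : Type := Theory {
  axioms : form -> Prop;
  rules : list form -> form -> Prop
}.

Inductive derives (T : theory) : form -> Prop :=
| der_axiom A : axioms T A -> derives T A
| der_rule ps A :
    rules T ps A -> (forall B, In B ps -> derives T B) -> derives T A.

Inductive mp_rule : list form -> form -> Prop :=
| mp_inst A B : mp_rule [A; Imp A B] B.

Inductive nec_rule : list form -> form -> Prop :=
| nec_inst A : nec_rule [A] (Box A).

Definition has_rule (T : theory) (r : list form -> form -> Prop) : Prop :=
  forall ps A, r ps A -> rules T ps A.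

Definition classical (T : theory) : Prop :=
  has_rule T mp_rule /\ forall A, tautology A -> derives T A.

Definition extends (T T' : theory) : Prop :=
  forall A, derives T A -> derives T' A.

Inductive GL_axiom : form -> Prop :=
| GL_taut A : tautology A -> GL_axiom A
| GL_K A B : GL_axiom (Imp (Box (Imp A B)) (Imp (Box A) (Box B)))
| GL_4 A : GL_axiom (Imp (Box A) (Box (Box A)))
| GL_Lob A : GL_axiom (Imp (Box (Imp (Box A) A)) (Box A)).

Definition GL : theory :=
  Theory GL_axiom (fun ps A => mp_rule ps A \/ nec_rule ps A).

Inductive ILM_scheme : form -> Prop :=
| ILM_J1 A B : ILM_scheme (Imp (Box (Imp A B)) (Rhd A B))
| ILM_J2 A B C : ILM_scheme (Imp (And (Rhd A B) (Rhd B C)) (Rhd A C))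
| ILM_J3 A B C : ILM_scheme (Imp (And (Rhd B A) (Rhd C A)) (Rhd (Or B C) A))
| ILM_J5 A : ILM_scheme (Rhd (Dia A) A)
| ILM_M A B C :
    ILM_scheme (Imp (Rhd A B) (Rhd (And (Box C) A) (And (Box C) B))).

Inductive ILM_axiom : form -> Prop :=
| ILM_GL A : derives GL A -> ILM_axiom A
| ILM_sch A : ILM_scheme A -> ILM_axiom A
| ILM_box A : ILM_scheme A -> ILM_axiom (Box A).

Definition ILM : theory := Theory ILM_axiom mp_rule.

Record frame : Type := Frame {
  world : Type;
  world_nonempty : inhabited world;
  acc : world -> world -> Prop;
  val : world -> nat -> Prop
}.

Definition has_pred (F : frame) (u : world F) : Prop := exists v, acc F v u.

(* A pre-model is a frame [F] with valuation together with theories [L w].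
   [L] is total for convenience; all the notions below only look at [L w] for
   [w] with [has_pred F w]. *)
Definition theories (F : frame) : Type := world F -> theory.

Fixpoint sat (F : frame) (L : theories F) (w : world F) (A : form) : Prop :=
  match A with
  | Atom p => val F w p
  | Bot => False
  | Imp B C => sat F L w B -> sat F L w C
  | Rhd B C =>
      forall u, acc F w u -> forall E,
        derives (L u) (Imp C (Dia E)) -> derives (L u) (Imp B (Dia E))
  end.

Definition acc_plus (F : frame) : world F -> world F -> Prop :=
  clos_trans (world F) (acc F).

Definition sat_plus (F : frame) (L : theories F) (w : world F) (A : form)
    : Prop :=
  exists u, acc F u w /\ forall v, acc_plus F u v -> sat F L v A.

Definition provability_model (F : frame) (L : theories F) : Prop :=
  (forall w, has_pred F w -> classical (L w)) /\
  (forall w A, has_pred F w -> purely_modal A ->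
     sat_plus F L w A -> derives (L w) A).

Definition necessitation (F : frame) (L : theories F) : Prop :=
  forall w, has_pred F w -> has_rule (L w) nec_rule.

Definition included (F : frame) (L L' : theories F) : Prop :=
  forall w, has_pred F w -> extends (L w) (L' w).

Definition bi_finite (F : frame) (L : theories F) : Prop :=
  Finite (world F) /\
  forall w, has_pred F w ->
    (exists l, forall A, axioms (L w) A -> In A l) /\
    (forall ps A, ~ rules (L w) ps A).

Definition tree (F : frame) : Prop :=
  forall w u v, acc F w v -> acc F u v ->
    w = u \/ acc_plus F w u \/ acc_plus F u w.

Definition converse_well_founded (F : frame) : Prop :=
  ~ exists f : nat -> world F, forall n, acc F (f n) (f (S n)).

Definition model_with_nec_over (F : frame) (L L' : theories F) : Prop :=
  provability_model F L' /\ necessitation F L' /\ included F L L'.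

Definition minimal_over (F : frame) (L L' : theories F) : Prop :=
  model_with_nec_over F L L' /\
  forall L'', model_with_nec_over F L L'' ->
    included F L'' L' -> included F L' L''.

(* Minimality at each single world: relative to the satisfaction relation of
   [L'], no theorem of [L' w] can be dropped. *)
Definition worldwise_minimal_over (F : frame) (L L' : theories F) : Prop :=
  forall w, has_pred F w -> forall T,
    classical T -> has_rule T nec_rule -> extends (L w) T ->
    (forall A, purely_modal A -> sat_plus F L' w A -> derives T A) ->
    extends (L' w) T.

(* Satisfaction is not monotone in the theories, so [minimal_over] alone does
   not determine [L'] from [L]: strengthening the theory of a maximal world can
   change what lower worlds are required to prove, and so lead to another,
   incomparable minimal model.  The worldwise condition picks out the model
   obtained from [L] by recursion along the converse well-founded tree, which
   is unique up to sets of theorems. *)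
Definition generated (F : frame) (L L' : theories F) : Prop :=
  minimal_over F L L' /\ worldwise_minimal_over F L L'.

Definition finitary (F : frame) (L' : theories F) : Prop :=
  exists L : theories F,
    bi_finite F L /\ tree F /\ converse_well_founded F /\ generated F L L'.

(* Main.v *)
(** Suppose [ILM] does not prove [A].  Call a maximal consistent set [N] a
    [C]-critical successor of [M] if [~G] and [Box ~G] are in [N] whenever
    [G |> C] is in [M].  If [B |> C] is not in [M], then [M] has a [C]-critical
    successor containing [B], and no [C]-critical successor contains [C].  If
    [B |> D] is in [M], then by Montagna's axiom any [C]-critical successor
    containing [B] can be replaced by one containing [D] with at least the same
    boxes, hence with no more successors.  Requiring in addition that one of
    finitely many boxes is gained at each step bounds the depth, so bisimilarity
    has finite index and the quotient is a finite structure.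

    The worlds of the provability model are the paths of labelled steps in this
    quotient.  The theory of a path ending with a [C]-labelled step from [M] to
    [N] is the theory of all [C]-labelled successors of [M] that see no more than
    [N] does.  The formulas [Dia E] then express exactly what a point sees, so
    that [B |> D] as conservativity for such formulas agrees with [B |> D] in
    the quotient.  Points of a finite structure are told apart by finitely many
    modal formulas, so a single axiom per world generates these theories. *)

From Stdlib Require Import List Relations FinFun Lia Arith Cantor.
From Stdlib Require Import Classical ClassicalEpsilon ProofIrrelevance.
Require Import Defs.
Import ListNotations.

(** * Finite lists and types, and elementary facts on derivability and satisfaction *)

Lemma Finite_sig (X : Type) (P : X -> Prop) (l : list X) :
  (forall x, P x -> In x l) -> Finite {x : X | P x}.
Proof.
  intros Hl.
  enough (H : exists l', forall x : {x | P x}, In (proj1_sig x) l -> In x l').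
  { destruct H as [l' H]. exists l'. intros [x Hx]. apply H, Hl, Hx. }
  clear Hl. induction l as [|a l [l' IH]].
  - exists []. intros x [].
  - destruct (classic (P a)) as [Ha | Ha].
    + exists (exist _ a Ha :: l'). intros [x Hx] Hin. simpl in Hin. destruct Hin as [<- | Hin].
      * left. f_equal. apply proof_irrelevance.
      * right. apply IH, Hin.
    + exists l'. intros [x Hx] Hin. simpl in Hin.
      destruct Hin as [<- | Hin]; [contradiction | apply IH, Hin].
Qed.

Lemma list_comprehension (X : Type) (P : X -> Prop) (l : list X) :
  exists l', forall x, In x l' <-> In x l /\ P x.
Proof.
  induction l as [|a l [l' IH]].
  - exists []. simpl. tauto.
  - destruct (classic (P a)) as [Ha | Ha].
    + exists (a :: l'). intros x. simpl. rewrite IH.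
      split; [intros [<- | ?] | intros [[<- | ?] ?]]; tauto.
    + exists l'. intros x. simpl. rewrite IH. split; [tauto|].
      intros [[<- | ?] ?]; tauto.
Qed.

Fixpoint words {X : Type} (al : list X) (n : nat) : list (list X) :=
  [] :: match n with
        | 0 => []
        | S n => flat_map (fun x => map (cons x) (words al n)) al
        end.

Lemma in_words (X : Type) (al : list X) (n : nat) (l : list X) :
  length l <= n -> incl l al -> In l (words al n).
Proof.
  revert n. induction l as [|x l IH]; intros n Hn Hl.
  - destruct n; left; reflexivity.
  - destruct n as [|n]; simpl in Hn; [lia|]. right. apply in_flat_map.
    exists x. split; [apply Hl; left; reflexivity|].
    apply in_map, IH; [lia | intros y Hy; apply Hl; right; exact Hy].
Qed.

Lemma filter_length_lt (X : Type) (f g : X -> bool) (l : list X) (x : X) :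
  (forall y, f y = true -> g y = true) -> In x l -> f x = false -> g x = true ->
  length (filter f l) < length (filter g l).
Proof.
  intros Hfg Hx Hf Hg.
  assert (Hle : forall l', length (filter f l') <= length (filter g l')).
  { induction l' as [|y l' IH]; [simpl; lia|]. simpl. specialize (Hfg y).
    destruct (f y), (g y); simpl; lia. }
  induction l as [|y l IH]; [destruct Hx|]. simpl.
  destruct Hx as [-> | Hx].
  - rewrite Hf, Hg. simpl. specialize (Hle l). lia.
  - specialize (IH Hx). specialize (Hfg y).
    destruct (f y), (g y); simpl; lia.
Qed.

Lemma derives_mp (T : theory) (A B : form) : has_rule T mp_rule ->
  derives T A -> derives T (Imp A B) -> derives T B.
Proof.
  intros HT HA HAB. apply (der_rule T [A; Imp A B]); [apply HT; constructor|].
  intros C [<- | [<- | []]]; assumption.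
Qed.

Lemma sat_ext (F : frame) (L L' : theories F) (w : world F) (A : form) :
  (forall u, acc F w u -> forall B, derives (L u) B <-> derives (L' u) B) ->
  (sat F L w A <-> sat F L' w A).
Proof.
  intros H. induction A as [p | | A IHA B IHB | A _ B _]; simpl.
  - reflexivity.
  - reflexivity.
  - rewrite IHA, IHB. reflexivity.
  - split; intros HR u Hu E; specialize (HR u Hu E);
      rewrite !(H u Hu) in *; exact HR.
Qed.

(** * Finite structures and their path frames *)

(** The common shape of the canonical structure and of its finite quotient. The label of a step
    stands for the formula for which the successor is critical; [rank] will bound the length of
    chains of steps. *)
Record lts : Type := Lts {
  pos : Type;
  lbl : Type;
  step : lbl -> pos -> pos -> Prop;
  lab : pos -> form -> Prop;
  rank : pos -> nat
}.

Arguments step {l}.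
Arguments lab {l}.
Arguments rank {l}.

Definition sees {K : lts} (w u : pos K) : Prop := exists j, step j w u.

(** Every [Dia E] true at [v] is then true at [u]. This is the direction in which a [Rhd] formula
    leads from a point of its antecedent to one of its consequent. *)
Definition below {K : lts} (u v : pos K) : Prop :=
  forall z, sees v z -> sees u z.

(** The composed step in [step_trans] keeps the first label, as criticality does. The conditions on
    compound formulas are restricted to [Phi], since a finite quotient can respect only finitely
    many formulas. *)
Record coherent (Phi : list form) (K : lts) : Prop := {
  step_trans : forall j i (w u v : pos K),
    step j w u -> step i u v -> step j w v;
  step_rank : forall j (w u : pos K), step j w u -> rank u < rank w;
  lab_bot : forall w : pos K, ~ lab w Bot;
  lab_imp : forall (w : pos K) A B, In (Imp A B) Phi ->
    (lab w (Imp A B) <-> (lab w A -> lab w B));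
  lab_rhd : forall (w a : pos K) j A B, In (Rhd A B) Phi ->
    lab w (Rhd A B) -> step j w a -> lab a A ->
    exists b, step j w b /\ below a b /\ lab b B;
  lab_not_rhd : forall (w : pos K) A B, In (Rhd A B) Phi ->
    ~ lab w (Rhd A B) ->
    exists j a, step j w a /\ lab a A /\ forall b, step j w b -> ~ lab b B
}.

Definition sub_closed (Phi : list form) : Prop :=
  forall A B, In (Imp A B) Phi \/ In (Rhd A B) Phi -> In A Phi /\ In B Phi.

Section PathFrame.
Context (Phi : list form) (K : lts).
Context (Phi_closed : sub_closed Phi) (K_coh : coherent Phi K).
Context (Js : list (lbl K)) (Ws : list (pos K)).
Context (in_Js : forall j (w u : pos K), step j w u -> In j Js) (in_Ws : Full Ws).

Lemma below_refl (u : pos K) : below u u.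
Proof. intros z Hz. exact Hz. Qed.

Lemma below_trans (u v w : pos K) : below u v -> below v w -> below u w.
Proof. intros H1 H2 z Hz. apply H1, H2, Hz. Qed.

Lemma sees_below (u v : pos K) : sees u v -> below u v.
Proof.
  intros [j Huv] z [i Hz]. exists j. exact (step_trans _ _ K_coh _ _ _ _ _ Huv Hz).
Qed.

(** * Forcing with generic atoms and the truth lemma *)

Definition agree (w : pos K) (s : nat -> Prop) : Prop :=
  forall p, In (Atom p) Phi -> (s p <-> lab w (Atom p)).

Definition own_val (w : pos K) (p : nat) : Prop := lab w (Atom p).

Lemma agree_own (w : pos K) : agree w (own_val w).
Proof. intros p _. reflexivity. Qed.

(* Atoms outside [Phi] are generic: a modal operator ranges over all their
   valuations, since no finite set of axioms could fix them. *)
Fixpoint forces (w : pos K) (s : nat -> Prop) (C : form) : Prop :=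
  match C with
  | Atom p => s p
  | Bot => False
  | Imp A B => forces w s A -> forces w s B
  | Rhd A B => forall j a s1, step j w a -> agree a s1 -> forces a s1 A ->
      exists b s2, step j w b /\ below a b /\ agree b s2 /\ forces b s2 B
  end.

Lemma forces_pm (w : pos K) (s s' : nat -> Prop) (C : form) :
  purely_modal C -> forces w s C <-> forces w s' C.
Proof. induction 1; simpl in *; tauto. Qed.

Lemma forces_and (w : pos K) (s : nat -> Prop) (A B : form) :
  forces w s (And A B) <-> forces w s A /\ forces w s B.
Proof. simpl. tauto. Qed.

Lemma forces_dia (w : pos K) (s : nat -> Prop) (E : form) :
  forces w s (Dia E) <->
  exists a s1, sees w a /\ agree a s1 /\ forces a s1 E.
Proof.
  simpl. split.
  - intros H. apply NNPP. intros Hn. apply H. intros j a s1 Ha Hs HE.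
    exfalso. apply HE. intros HE'. apply Hn. exists a, s1.
    split; [exists j|]; auto.
  - intros (a & s1 & [j Ha] & Hs & HE) H.
    destruct (H j a s1 Ha Hs) as (? & ? & ? & ? & ? & []). tauto.
Qed.

Lemma forces_box (w : pos K) (s : nat -> Prop) (E : form) :
  forces w s (Box E) <->
  forall a s1, sees w a -> agree a s1 -> forces a s1 E.
Proof.
  simpl. split.
  - intros H a s1 [j Ha] Hs. apply NNPP. intros HE.
    destruct (H j a s1 Ha Hs HE) as (? & ? & ? & ? & ? & []).
  - intros H j a s1 Ha Hs HE. exfalso. apply HE, H; [exists j|]; auto.
Qed.

Lemma forces_tautology (w : pos K) (s : nat -> Prop) (C : form) :
  tautology C -> forces w s C.
Proof.
  set (v := fun A => if excluded_middle_informative (forces w s A)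
                     then true else false).
  assert (Hv : forall A, v A = true <-> forces w s A).
  { intros A. unfold v.
    destruct (excluded_middle_informative (forces w s A)); split; congruence. }
  assert (He : forall A, beval v A = true <-> forces w s A).
  { induction A as [p | | A IHA B IHB | A IHA B IHB]; cbn [beval].
    - apply Hv.
    - simpl. split; [discriminate | tauto].
    - simpl. rewrite <- IHA, <- IHB.
      destruct (beval v A), (beval v B); simpl; intuition congruence.
    - apply Hv. }
  intros H. apply He, H.
Qed.

(** Truth lemma. Quantifying over valuations is harmless here, because the atoms of a formula in
    [Phi] are again in [Phi] and so are fixed by [agree]. *)
Lemma forces_lab (C : form) : In C Phi -> forall w s, agree w s ->
  (forces w s C <-> lab w C).
Proof.
  induction C as [p | | A IHA B IHB | A IHA B IHB]; intros HC w s Hs.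
  - apply Hs, HC.
  - simpl. pose proof (lab_bot _ _ K_coh w). tauto.
  - destruct (Phi_closed A B (or_introl HC)) as [HA HB]. simpl.
    rewrite (lab_imp _ _ K_coh w A B HC), (IHA HA w s Hs), (IHB HB w s Hs).
    reflexivity.
  - destruct (Phi_closed A B (or_intror HC)) as [HA HB]. simpl. split.
    + intros H. apply NNPP. intros Hn.
      destruct (lab_not_rhd _ _ K_coh w A B HC Hn) as (j & a & Ha & HaA & Hb).
      destruct (H j a (own_val a) Ha (agree_own a)) as (b & s2 & Hwb & _ & Hs2 & HbB).
      { apply (IHA HA); [apply agree_own | exact HaA]. }
      apply (Hb b Hwb), (IHB HB b s2 Hs2), HbB.
    + intros H j a s1 Ha Hs1 HaA. apply (IHA HA) in HaA; [|exact Hs1].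
      destruct (lab_rhd _ _ K_coh w a j A B HC H Ha HaA) as (b & Hwb & Hab & HbB).
      exists b, (own_val b). repeat split; auto.
      apply (IHB HB); [apply agree_own | exact HbB].
Qed.

(** * Local theories and conservativity *)

Definition reach (j : lbl K) (w u b : pos K) : Prop := step j w b /\ below u b.

Definition local_valid (P : pos K -> Prop) (C : form) : Prop :=
  forall b s, P b -> agree b s -> forces b s C.

(** All valid formulas are taken as axioms; the rules are added because a classical theory with
    necessitation must have them as rules, and for sets [reach j w u] they yield nothing new. *)
Definition local_theory (P : pos K -> Prop) : theory :=
  Theory (local_valid P) (fun ps A => mp_rule ps A \/ nec_rule ps A).

(** Necessitation is sound because [reach j w u] contains every point seen from its members:
    composed steps keep the label [j], and a point seen from [b] sees no more than [b]. *)
Lemma derives_local_theory (j : lbl K) (w u : pos K) (C : form) :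
  derives (local_theory (reach j w u)) C <-> local_valid (reach j w u) C.
Proof.
  split; [|intros H; apply der_axiom, H].
  induction 1 as [C HC | ps C Hr _ IH]; [exact HC|].
  intros b s Hb Hs.
  destruct Hr as [Hr | Hr]; [destruct Hr as [A B] | destruct Hr as [A]].
  - apply (IH (Imp A B)) with (b := b) (s := s); simpl; auto.
    apply (IH A); simpl; auto.
  - apply forces_box. intros a s1 Ha Hs1. apply (IH A); [left; reflexivity| |exact Hs1].
    destruct Hb as [Hwb Hub]. split.
    + destruct Ha as [i Ha]. exact (step_trans _ _ K_coh _ _ _ _ _ Hwb Ha).
    + exact (below_trans _ _ _ Hub (sees_below _ _ Ha)).
Qed.

(** From left to right, each point forcing [A] has a point forcing [B] that sees no more, so a
    [Dia E] holding at the latter already holds at the former. For the converse a single [E]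
    suffices. *)
Lemma rhd_local_theory (w : pos K) (s : nat -> Prop) (A B : form) :
  forces w s (Rhd A B) <->
  forall j u, step j w u -> forall E,
    local_valid (reach j w u) (Imp B (Dia E)) ->
    local_valid (reach j w u) (Imp A (Dia E)).
Proof.
  split.
  - intros H j u Hu E HE x s1 [Hwx Hux] Hs1 HxA.
    destruct (H j x s1 Hwx Hs1 HxA) as (b & s2 & Hwb & Hxb & Hs2 & HbB).
    assert (Hb : forces b s2 (Dia E)).
    { apply (HE b s2); auto. split; [exact Hwb|].
      exact (below_trans _ _ _ Hux Hxb). }
    apply forces_dia in Hb. apply forces_dia.
    destruct Hb as (c & s3 & Hbc & Hc). exists c, s3. split; auto.
  - intros H j a s1 Ha Hs1 HaA. apply NNPP. intros Hn.
    assert (Hdia : forall x s', forces x s' (Dia Bot) -> False).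
    { intros x s' Hx. apply forces_dia in Hx. destruct Hx as (? & ? & ? & ? & []). }
    (* [E := Bot]: the theory of [reach j w a] refutes [B] but not [A]. *)
    apply (Hdia a s1). apply (H j a Ha Bot); auto.
    + intros b s2 [Hwb Hab] Hs2 HbB. exfalso. apply Hn. exists b, s2. auto.
    + split; [exact Ha | apply below_refl].
Qed.

(** * Characteristic formulas of points and of sets of points *)

(** Each point of [l] that lacks some modal truth of [b] contributes one such truth to the
    conjunction [X]; the remaining points share all modal truths of [b]. *)
Lemma distinguish (b : pos K) (l : list (pos K)) :
  exists X, purely_modal X /\ forces b (own_val b) X /\
    forall y, In y l -> forces y (own_val y) X ->
      forall N, purely_modal N -> forces b (own_val b) N -> forces y (own_val y) N.
Proof.
  induction l as [|y l (X & HX & HbX & IH)].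
  - exists (Imp Bot Bot). repeat split; [repeat constructor | simpl; tauto |].
    intros y [].
  - destruct (classic (forall N, purely_modal N -> forces b (own_val b) N ->
                                 forces y (own_val y) N)) as [Hy | Hy].
    + exists X. repeat split; auto. intros z [<- | Hz]; auto.
    + apply not_all_ex_not in Hy. destruct Hy as [N HN].
      apply imply_to_and in HN. destruct HN as [HN HbN].
      apply imply_to_and in HbN. destruct HbN as [HbN HyN].
      exists (And N X). split; [repeat constructor; auto|].
      split; [apply forces_and; auto|].
      intros z Hz HzX. apply forces_and in HzX.
      destruct Hz as [<- | Hz]; [tauto | apply IH; tauto].
Qed.

(** [N] records the truth values at [b] of the outermost [Rhd] subformulas of [C]. A Boolean
    valuation respecting [N] can then differ from [b] on [C] only through the atoms. *)
Lemma modal_diagram (b : pos K) (C : form) :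
  exists N, purely_modal N /\ forces b (own_val b) N /\
    forall v, beval v N = true ->
      (beval v C = true <-> forces b (fun p => v (Atom p) = true) C).
Proof.
  induction C as [p | | A (NA & pA & fA & HA) B (NB & pB & fB & HB) | A _ B _].
  - exists (Imp Bot Bot). repeat split; [repeat constructor | simpl; tauto | |]; auto.
  - exists (Imp Bot Bot). repeat split; [repeat constructor | simpl; tauto | |];
      simpl; [discriminate | tauto].
  - exists (And NA NB). split; [repeat constructor; auto|].
    split; [apply forces_and; auto|].
    intros v Hv. cbn in Hv.
    destruct (beval v NA) eqn:EA; [|discriminate].
    destruct (beval v NB) eqn:EB; [|discriminate].
    specialize (HA v EA). specialize (HB v EB). simpl. rewrite <- HA, <- HB.
    destruct (beval v A), (beval v B); simpl; intuition congruence.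
  - destruct (classic (forces b (own_val b) (Rhd A B))) as [H | H].
    + exists (Rhd A B). split; [constructor|]. split; [exact H|].
      intros v Hv. split; [intros _; exact H | intros _; exact Hv].
    + exists (Neg (Rhd A B)). split; [repeat constructor|]. split; [exact H|].
      intros v Hv. split; [|intros HR; elim (H HR)].
      intros Hc. cbn in Hv, Hc. rewrite Hc in Hv. discriminate.
Qed.

Lemma atomic_diagram (b : pos K) (l : list form) : incl l Phi ->
  exists Z, (forall s, agree b s -> forces b s Z) /\
    forall v, beval v Z = true ->
      forall p, In (Atom p) l -> (v (Atom p) = true <-> lab b (Atom p)).
Proof.
  induction l as [|C l IH]; intros Hl.
  - exists (Imp Bot Bot). split; [simpl; tauto | intros v _ p []].
  - destruct IH as (Z & HZ & HvZ); [intros x Hx; apply Hl; right; exact Hx|].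
    destruct C as [p | | |].
    2-4: exists Z; split; [exact HZ | intros v Hv p [Hp | Hp]; [discriminate | auto]].
    assert (Hp : In (Atom p) Phi) by (apply Hl; left; reflexivity).
    destruct (classic (lab b (Atom p))) as [Hb | Hb].
    + exists (And (Atom p) Z). split.
      * intros s Hs. apply forces_and. split; [apply Hs; auto | auto].
      * intros v Hv q. cbn in Hv.
        destruct (v (Atom p)) eqn:Ep; [|discriminate].
        destruct (beval v Z) eqn:EZ; [|discriminate].
        intros [Hq | Hq]; [injection Hq as <-; tauto | auto].
    + exists (And (Neg (Atom p)) Z). split.
      * intros s Hs. apply forces_and.
        split; [intros Hp'; apply Hb, Hs; auto | auto].
      * intros v Hv q. cbn in Hv.
        destruct (v (Atom p)) eqn:Ep; [discriminate|].
        destruct (beval v Z) eqn:EZ; [|discriminate].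
        intros [Hq | Hq]; [injection Hq as <- | auto].
        rewrite Ep. split; [discriminate | tauto].
Qed.

(** Modal completeness puts these formulas into every theory of the path model, so a base axiom need
    only imply a formula modulo them. *)
Definition modal_valid (M : form) : Prop :=
  purely_modal M /\ forall y, forces y (own_val y) M.

(** [Th] joins a modal formula [X] separating [b] from the points with other modal truths to the
    atomic diagram [Z]. Given [C], the formula [X -> N] with the modal diagram [N] of [C] supplies
    the rest. *)
Lemma characteristic_point (b : pos K) :
  exists Th, (forall s, agree b s -> forces b s Th) /\
    forall C, (forall s, agree b s -> forces b s C) ->
      exists M, modal_valid M /\ tautology (Imp Th (Imp M C)).
Proof.
  destruct (distinguish b Ws) as (X & pX & fX & HX).
  destruct (atomic_diagram b Phi (incl_refl Phi)) as (Z & fZ & HZ).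
  exists (And X Z). split.
  - intros s Hs. apply forces_and. split; [|auto].
    apply (forces_pm b (own_val b)); auto.
  - intros C HC. destruct (modal_diagram b C) as (N & pN & fN & HN).
    exists (Imp X N). split.
    (* Wherever [X] holds, all modal truths of [b] hold, [N] among them. *)
    + split; [constructor; auto|]. intros y Hy. apply (HX y); auto.
    + intros v. cbn.
      destruct (beval v X); [|reflexivity].
      destruct (beval v Z) eqn:EZ; [|reflexivity].
      destruct (beval v N) eqn:EN; [|reflexivity].
      (* By [Z], the atoms true under [v] form a valuation that agrees with [b], so [C] is forced
         there; [N] carries this back to [v]. *)
      cbn. rewrite (proj2 (HN v EN)); [reflexivity|]. apply HC.
      intros p Hp. apply (HZ v EZ p Hp).
Qed.

(** As there are finitely many points, the formulas of the members of [P] can be disjoined and the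
    accompanying modal formulas conjoined. *)
Lemma characteristic_set (P : pos K -> Prop) :
  exists Th, local_valid P Th /\
    forall C, local_valid P C ->
      exists M, modal_valid M /\ tautology (Imp Th (Imp M C)).
Proof.
  destruct (list_comprehension _ P Ws) as [l Hl].
  enough (H : exists Th, local_valid (fun b => In b l) Th /\
    forall C, local_valid (fun b => In b l) C ->
      exists M, modal_valid M /\ tautology (Imp Th (Imp M C))).
  { destruct H as (Th & H1 & H2). exists Th. split.
    - intros b s Hb. apply H1, Hl. auto.
    - intros C HC. apply H2. intros b s Hb. apply HC, Hl, Hb. }
  clear Hl. induction l as [|b l (Th & H1 & H2)].
  - exists Bot. split; [intros b s []|]. intros C _. exists (Imp Bot Bot).
    split; [split; [repeat constructor | intros y; simpl; tauto] | intros v; reflexivity].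
  - destruct (characteristic_point b) as (Tb & Hb1 & Hb2).
    exists (Or Tb Th). split.
    + intros c s Hc Hs. simpl. intros Hn. destruct Hc as [<- | Hc].
      * elim Hn. apply Hb1, Hs.
      * apply H1; auto.
    + intros C HC. destruct (Hb2 C) as (M1 & [p1 v1] & t1).
      { intros s. apply HC. left. reflexivity. }
      destruct (H2 C) as (M2 & [p2 v2] & t2).
      { intros c s Hc. apply HC. right. exact Hc. }
      exists (And M1 M2). split.
      * split; [repeat constructor; auto|]. intros y. apply forces_and. auto.
      * intros v. specialize (t1 v). specialize (t2 v). cbn in *.
        destruct (beval v Tb), (beval v Th), (beval v M1), (beval v M2), (beval v C);
          simpl in *; congruence.
Qed.

Definition char_formula (P : pos K -> Prop) : form :=
  proj1_sig (constructive_indefinite_description _ (characteristic_set P)).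

Lemma char_formula_valid (P : pos K -> Prop) : local_valid P (char_formula P).
Proof.
  unfold char_formula. destruct constructive_indefinite_description as [Th [H1 H2]].
  exact H1.
Qed.

Lemma char_formula_complete (P : pos K -> Prop) (C : form) :
  local_valid P C ->
  exists M, modal_valid M /\ tautology (Imp (char_formula P) (Imp M C)).
Proof.
  unfold char_formula. destruct constructive_indefinite_description as [Th [H1 H2]].
  exact (H2 C).
Qed.

(** * The path model: modal completeness, minimality and finiteness *)

Context (root : pos K).

(* Paths list their steps in reverse order and leave the root implicit. *)
Definition path : Type := list (lbl K * pos K).

Definition endpoint (l : path) : pos K :=
  match l with [] => root | (_, u) :: _ => u end.

Fixpoint valid_path (l : path) : Prop :=
  match l with
  | [] => True
  | (j, u) :: l => step j (endpoint l) u /\ valid_path l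
  end.

Definition node : Type := {l : path | valid_path l}.

Definition target (x : node) : pos K := endpoint (proj1_sig x).

Definition extend (x : node) (j : lbl K) (u : pos K) (H : step j (target x) u) : node :=
  exist valid_path ((j, u) :: proj1_sig x) (conj H (proj2_sig x)).

Definition path_frame : frame :=
  Frame node (inhabits (exist valid_path [] I))
    (fun x y => exists e, proj1_sig y = e :: proj1_sig x)
    (fun x => own_val (target x)).

(** The points to which the last step, with its label, could have led without seeing more than the
    actual endpoint. The empty path has no predecessor and gets the empty set as a default. *)
Definition positions (x : node) : pos K -> Prop :=
  match proj1_sig x with
  | [] => fun _ => False
  | (j, u) :: l => reach j (endpoint l) u
  end.

Definition base_theories : theories path_frame :=
  fun x => Theory (eq (char_formula (positions x))) (fun _ _ => False).

Definition path_theories : theories path_frame :=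
  fun x => local_theory (positions x).

Lemma acc_inv (x y : node) : acc path_frame x y ->
  exists j u, step j (target x) u /\ target y = u /\
    positions y = reach j (target x) u.
Proof.
  destruct y as [ly Hy]. intros [[j u] E]. simpl in E. subst ly.
  exists j, u. split; [apply Hy | split; reflexivity].
Qed.

Lemma acc_extend (x : node) (j : lbl K) (u : pos K) (H : step j (target x) u) :
  acc path_frame x (extend x j u H).
Proof. exists (j, u). reflexivity. Qed.

Lemma acc_unique (x y z : node) :
  acc path_frame x z -> acc path_frame y z -> x = y.
Proof.
  intros [e1 E1] [e2 E2]. rewrite E1 in E2. injection E2 as _ E.
  destruct x as [lx Hx], y as [ly Hy]. simpl in E. subst ly.
  f_equal. apply proof_irrelevance.
Qed.

Lemma acc_plus_sees (x y : node) : acc_plus path_frame x y ->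
  sees (target x) (target y).
Proof.
  induction 1 as [x y Hxy | x y z _ [j IH1] _ [i IH2]].
  - destruct (acc_inv x y Hxy) as (j & u & Hu & <- & _). exists j. exact Hu.
  - exists j. exact (step_trans _ _ K_coh _ _ _ _ _ IH1 IH2).
Qed.

(** The successors of [x] are exactly its one-step extensions, so the clause for [Rhd] is the
    conservativity statement of [rhd_local_theory]. *)
Lemma sat_path_theories (C : form) (x : node) :
  sat path_frame path_theories x C <-> forces (target x) (own_val (target x)) C.
Proof.
  induction C as [p | | A IHA B IHB | A _ B _].
  - reflexivity.
  - reflexivity.
  - simpl in *. rewrite IHA, IHB. reflexivity.
  - rewrite rhd_local_theory. cbn [sat]. split.
    + intros H j u Hu E. rewrite <- !derives_local_theory.
      exact (H (extend x j u Hu) (acc_extend x j u Hu) E).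
    + intros H y Hy E. destruct (acc_inv x y Hy) as (j & u & Hu & _ & EP).
      unfold path_theories. rewrite EP, !derives_local_theory. apply H, Hu.
Qed.

Lemma derives_path_theories (x : node) (C : form) : has_pred path_frame x ->
  derives (path_theories x) C <-> local_valid (positions x) C.
Proof.
  intros [y Hy]. destruct (acc_inv y x Hy) as (j & u & _ & _ & EP).
  unfold path_theories. rewrite EP. apply derives_local_theory.
Qed.

Lemma path_model_over :
  model_with_nec_over path_frame base_theories path_theories.
Proof.
  repeat split.
  - intros ps A HA. left. exact HA.
  - intros A HA. apply derives_path_theories; auto.
    intros b s _ _. apply forces_tautology, HA.
  - intros x A Hx pA (y & Hy & HA). apply derives_path_theories; auto.
    destruct (acc_inv y x Hy) as (j & u & _ & _ & ->).
    (* Every position [b] of [x] is itself the endpoint of an extension of [y], a world above [y],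
       and [A] holds there. *)
    intros b s [Hb _] _. apply (forces_pm b (own_val b)); auto.
    apply (sat_path_theories A (extend y j b Hb)), HA.
    apply t_step, acc_extend.
  - intros x _ ps A HA. right. exact HA.
  - intros x Hx A HA. apply derives_path_theories; auto.
    destruct HA as [A <- | ps A [] _]. apply char_formula_valid.
Qed.

(** A theorem follows from the base axiom and a modal formula true at all worlds. The former is in
    [T] by inclusion, the latter by modal completeness. *)
Lemma path_worldwise_minimal :
  worldwise_minimal_over path_frame base_theories path_theories.
Proof.
  intros x Hx T [Tmp Ttaut] _ Tbase Tmod A HA.
  apply derives_path_theories in HA; [|exact Hx].
  destruct (char_formula_complete _ _ HA) as (M & [pM vM] & HM).
  apply (derives_mp T M); [exact Tmp | |].
  - apply Tmod; [exact pM|]. destruct Hx as [y Hy]. exists y. split; [exact Hy|].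
    intros v _. apply sat_path_theories, vM.
  - apply (derives_mp T (char_formula (positions x))); [exact Tmp | | apply Ttaut, HM].
    apply Tbase, der_axiom. reflexivity.
Qed.

(* Satisfaction at the worlds above [y] only involves theories of worlds whose
   predecessor has smaller rank than [y], so minimality follows by induction. *)
Lemma path_minimal : minimal_over path_frame base_theories path_theories.
Proof.
  split; [exact path_model_over|].
  intros L [[Lcl Lmod] [Lnec Lbase]] Lsub.
  enough (H : forall n (y x : node), rank (target y) < n -> acc path_frame y x ->
                extends (path_theories x) (L x)).
  { intros x [y Hy]. exact (H (S (rank (target y))) y x (Nat.lt_succ_diag_r _) Hy). }
  induction n as [|n IH]; intros y x Hn Hyx; [lia|].
  assert (Hx : has_pred path_frame x) by (exists y; exact Hyx).
  apply path_worldwise_minimal; auto. intros A pA (y' & Hy' & HA).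
  rewrite (acc_unique y' y x Hy' Hyx) in HA.
  apply Lmod; [exact Hx | exact pA |]. exists y. split; [exact Hyx|].
  intros v Hv. apply (sat_ext _ path_theories); [|apply HA, Hv].
  intros u Hu B. split.
  - apply (IH v u); [|exact Hu].
    destruct (acc_plus_sees y v Hv) as [j Hj].
    pose proof (step_rank _ _ K_coh _ _ _ Hj). lia.
  - apply Lsub. exists v. exact Hu.
Qed.

(** Each step lowers the rank, so paths are words of bounded length over a finite alphabet. *)
Lemma path_bounded (l : path) : valid_path l ->
  length l + rank (endpoint l) <= rank root /\ incl l (list_prod Js Ws).
Proof.
  induction l as [|[j u] l IH]; simpl.
  - intros _. split; [lia | intros e []].
  - intros [Hu Hl]. destruct (IH Hl) as [Hlen Hin].
    pose proof (step_rank _ _ K_coh _ _ _ Hu). split; [lia|].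
    intros e [<- | He]; [|apply Hin, He].
    apply in_prod; [exact (in_Js _ _ _ Hu) | apply in_Ws].
Qed.

Lemma path_finitary : finitary path_frame path_theories.
Proof.
  exists base_theories. split; [split | split; [|split; [|split]]].
  - apply (Finite_sig path valid_path (words (list_prod Js Ws) (rank root))).
    intros l Hl. destruct (path_bounded l Hl) as [H1 H2].
    apply in_words; [lia | exact H2].
  - intros x _. split; [|intros ps A []].
    exists [char_formula (positions x)]. intros A HA. left. exact HA.
  - intros w u v Hw Hu. left. exact (acc_unique w u v Hw Hu).
  - intros [f Hf].
    assert (H : forall n, n + rank (target (f n)) <= rank (target (f 0))).
    { induction n as [|n IH]; [lia|].
      destruct (acc_plus_sees (f n) (f (S n))) as [j Hj]; [apply t_step, Hf|].
      pose proof (step_rank _ _ K_coh _ _ _ Hj). lia. }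
    specialize (H (S (rank (target (f 0))))). lia.
  - exact path_minimal.
  - exact path_worldwise_minimal.
Qed.

Lemma finitary_model_of_coherent (C : form) : In C Phi ->
  exists (F : frame) (L : theories F) (w : world F),
    finitary F L /\ (sat F L w C <-> lab root C).
Proof.
  intros HC. exists path_frame, path_theories, (exist valid_path [] I).
  split; [exact path_finitary|].
  rewrite sat_path_theories. apply forces_lab; [exact HC | apply agree_own].
Qed.

End PathFrame.

(** * Finite quotients *)

(** Splitting [Q] by one predicate after another leaves one representative for each realised
    combination of truth values. *)
Lemma finite_index (X : Type) (Ps : list (X -> Prop)) (Q : X -> Prop) :
  exists l, forall x, Q x ->
    exists y, In y l /\ Q y /\ forall P, In P Ps -> (P x <-> P y).
Proof.
  revert Q. induction Ps as [|P Ps IH]; intros Q.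
  - destruct (classic (exists x, Q x)) as [[y Hy] | Hn].
    + exists [y]. intros x _. exists y. simpl. tauto.
    + exists []. intros x Hx. elim Hn. exists x. exact Hx.
  - destruct (IH (fun x => Q x /\ P x)) as [l1 H1].
    destruct (IH (fun x => Q x /\ ~ P x)) as [l2 H2].
    exists (l1 ++ l2). intros x Hx. destruct (classic (P x)) as [Px | Px].
    + destruct (H1 x (conj Hx Px)) as (y & Hy & [Qy Py] & Hxy).
      exists y. split; [apply in_or_app; tauto|]. split; [exact Qy|].
      intros P' [<- | HP]; [tauto | auto].
    + destruct (H2 x (conj Hx Px)) as (y & Hy & [Qy Py] & Hxy).
      exists y. split; [apply in_or_app; tauto|]. split; [exact Qy|].
      intros P' [<- | HP]; [tauto | auto].
Qed.

Section Quotient.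
Context (Phi obs : list form) (K : lts).
Context (Phi_closed : sub_closed Phi) (K_coh : coherent Phi K).
Context (Phi_obs : incl Phi obs).
Context (Js : list (lbl K)).
Context (in_Js : forall j (w u : pos K), step j w u -> In j Js).
Context (rank_obs : forall w u : pos K,
           (forall C, In C obs -> (lab w C <-> lab u C)) -> rank w = rank u).
Context (N : nat) (rank_bound : forall w : pos K, rank w <= N).

(** Bisimilarity up to depth [n], with the formulas in [obs] in the role of atoms. *)
Fixpoint sim (n : nat) (w u : pos K) : Prop :=
  (forall C, In C obs -> (lab w C <-> lab u C)) /\
  match n with
  | 0 => True
  | S n =>
      (forall j w', step j w w' -> exists u', step j u u' /\ sim n w' u') /\
      (forall j u', step j u u' -> exists w', step j w w' /\ sim n w' u')
  end.

Lemma sim_obs (n : nat) (w u : pos K) :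
  sim n w u -> forall C, In C obs -> (lab w C <-> lab u C).
Proof. destruct n; intros [H _]; exact H. Qed.

Lemma sim_sym (n : nat) (w u : pos K) : sim n w u -> sim n u w.
Proof.
  revert w u. induction n as [|n IH]; intros w u [H1 H2].
  - split; [|exact I]. intros C HC. rewrite (H1 C HC). reflexivity.
  - destruct H2 as [H2 H3]. split.
    { intros C HC. rewrite (H1 C HC). reflexivity. }
    split.
    + intros j u' Hu. destruct (H3 j u' Hu) as (w' & Hw & Hs). eauto.
    + intros j w' Hw. destruct (H2 j w' Hw) as (u' & Hu & Hs). eauto.
Qed.

Lemma sim_trans (n : nat) (w u v : pos K) : sim n w u -> sim n u v -> sim n w v.
Proof.
  revert w u v. induction n as [|n IH]; intros w u v [H1 H2] [H3 H4].
  - split; [|exact I]. intros C HC. rewrite (H1 C HC). auto.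
  - destruct H2 as [Hf Hb], H4 as [Hf' Hb']. split.
    { intros C HC. rewrite (H1 C HC). auto. }
    split.
    + intros j w' Hw. destruct (Hf j w' Hw) as (u' & Hu & Hs).
      destruct (Hf' j u' Hu) as (v' & Hv & Hs'). eauto.
    + intros j v' Hv. destruct (Hb' j v' Hv) as (u' & Hu & Hs).
      destruct (Hb j u' Hu) as (w' & Hw & Hs'). eauto.
Qed.

Lemma sim_rank (n : nat) (w u : pos K) : sim n w u -> rank w = rank u.
Proof. intros H. exact (rank_obs w u (sim_obs n w u H)). Qed.

(** Steps lower the rank, and related points have equal rank, so beyond depth [n] neither side can
    move. Hence [sim N] is a full bisimulation. *)
Lemma sim_succ (n : nat) (w u : pos K) : rank w <= n ->
  sim n w u -> sim (S n) w u.
Proof.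
  revert w u. induction n as [|n IH]; intros w u Hn H.
  - pose proof (sim_rank _ _ _ H) as Hr. destruct H as [H _].
    split; [exact H|].
    split; intros j x Hx; pose proof (step_rank _ _ K_coh _ _ _ Hx); lia.
  - destruct H as [H [Hf Hb]]. split; [exact H|]. split.
    + intros j w' Hw. destruct (Hf j w' Hw) as (u' & Hu & Hs).
      exists u'. split; [exact Hu|]. apply IH; [|exact Hs].
      pose proof (step_rank _ _ K_coh _ _ _ Hw). lia.
    + intros j u' Hu. destruct (Hb j u' Hu) as (w' & Hw & Hs).
      exists w'. split; [exact Hw|]. apply IH; [|exact Hs].
      pose proof (step_rank _ _ K_coh _ _ _ Hw). lia.
Qed.

Lemma sim_step (w u w' : pos K) (j : lbl K) :
  sim N w u -> step j w w' -> exists u', step j u u' /\ sim N w' u'.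
Proof. intros H. exact (proj1 (proj2 (sim_succ N w u (rank_bound w) H)) j w'). Qed.

(** The class at depth [n + 1] is determined by the observed formulas and by which depth-[n] classes
    are reached under which labels; these are finitely many predicates. *)
Lemma sim_finite_index (n : nat) :
  exists l, forall w, exists u, In u l /\ sim n w u.
Proof.
  set (labs := map (fun C (w : pos K) => lab w C) obs).
  assert (Hlabs : forall w u : pos K, (forall P, In P labs -> (P w <-> P u)) ->
                    forall C, In C obs -> (lab w C <-> lab u C)).
  { intros w u H C HC. apply (H (fun w => lab w C)).
    apply (in_map (fun C (w : pos K) => lab w C)), HC. }
  induction n as [|n [l Hl]].
  - destruct (finite_index _ labs (fun _ => True)) as [l Hl]. exists l. intros w.
    destruct (Hl w I) as (u & Hu & _ & H). exists u. split; [exact Hu|].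
    split; auto.
  - set (succs := map (fun e (w : pos K) =>
                         exists w', step (fst e) w w' /\ sim n w' (snd e))
                      (list_prod Js l)).
    destruct (finite_index _ (labs ++ succs) (fun _ => True)) as [l' Hl'].
    exists l'. intros w. destruct (Hl' w I) as (u & Hu & _ & H).
    exists u. split; [exact Hu|].
    assert (Hsucc : forall j c, In j Js -> In c l ->
        ((exists w', step j w w' /\ sim n w' c) <->
         (exists u', step j u u' /\ sim n u' c))).
    { intros j c Hj Hc.
      apply (H (fun w => exists w', step j w w' /\ sim n w' c)).
      apply in_or_app. right.
      exact (in_map (fun e (w : pos K) =>
                       exists w', step (fst e) w w' /\ sim n w' (snd e))
                    _ (j, c) (in_prod _ _ _ _ Hj Hc)). }
    split; [apply Hlabs; intros P HP; apply H, in_or_app; left; exact HP|]. split.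
    + intros j w' Hw. destruct (Hl w') as (c & Hc & Hs).
      destruct (proj1 (Hsucc j c (in_Js _ _ _ Hw) Hc)) as (u' & Hu' & Hs'); [eauto|].
      exists u'. split; [exact Hu'|].
      exact (sim_trans _ _ _ _ Hs (sim_sym _ _ _ Hs')).
    + intros j u' Hu'. destruct (Hl u') as (c & Hc & Hs).
      destruct (proj2 (Hsucc j c (in_Js _ _ _ Hu') Hc)) as (w' & Hw & Hs'); [eauto|].
      exists w'. split; [exact Hw|].
      exact (sim_trans _ _ _ _ Hs' (sim_sym _ _ _ Hs)).
Qed.

(** The points are representatives instead of classes; a step leads to any representative bisimilar
    to an actual successor. *)
Definition quotient (l : list (pos K)) : lts :=
  Lts {w : pos K | In w l} (lbl K)
    (fun j w u => exists v, step j (proj1_sig w) v /\ sim N v (proj1_sig u))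
    (fun w => lab (proj1_sig w)) (fun w => rank (proj1_sig w)).

(** What a point sees is invariant under bisimilarity up to bisimilarity of the points seen, and
    quotient steps are insensitive to the latter. *)
Lemma quotient_below (l : list (pos K)) (u v : pos (quotient l)) (u' v' : pos K) :
  sim N u' (proj1_sig u) -> sim N v' (proj1_sig v) ->
  below u' v' -> below u v.
Proof.
  intros Hu Hv H z (j & y & Hy & Hyz).
  destruct (sim_step _ _ _ _ (sim_sym _ _ _ Hv) Hy) as (y' & Hy' & Hyy').
  destruct (H y') as [i Hi]; [exists j; exact Hy'|].
  destruct (sim_step _ _ _ _ Hu Hi) as (x & Hx & Hy'x).
  exists i, x. split; [exact Hx|]. apply sim_sym in Hyy'. apply sim_sym in Hy'x.
  exact (sim_trans _ _ _ _ (sim_trans _ _ _ _ Hy'x Hyy') Hyz).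
Qed.

Lemma quotient_coherent (l : list (pos K)) :
  (forall w, exists u, In u l /\ sim N w u) -> coherent Phi (quotient l).
Proof.
  intros Hl. split.
  - intros j i w u v (x & Hx & Hxu) (y & Hy & Hyv).
    destruct (sim_step _ _ _ _ (sim_sym _ _ _ Hxu) Hy) as (z & Hz & Hyz).
    exists z. split; [exact (step_trans _ _ K_coh _ _ _ _ _ Hx Hz)|].
    exact (sim_trans _ _ _ _ (sim_sym _ _ _ Hyz) Hyv).
  - intros j w u (x & Hx & Hxu). simpl.
    rewrite <- (sim_rank _ _ _ Hxu). exact (step_rank _ _ K_coh _ _ _ Hx).
  - intros w. apply (lab_bot _ _ K_coh).
  - intros w. apply (lab_imp _ _ K_coh).
  - intros w u j A B HAB Hw (x & Hx & Hxu) Hu.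
    destruct (Phi_closed A B (or_intror HAB)) as [HA HB].
    destruct (lab_rhd _ _ K_coh (proj1_sig w) x j A B HAB Hw Hx) as (b & Hb & Hxb & HbB).
    { apply (sim_obs _ _ _ Hxu); auto. }
    destruct (Hl b) as (c & Hc & Hbc).
    exists (exist (fun w => In w l) c Hc). split; [exists b; auto|]. split.
    + apply (quotient_below l u (exist (fun w => In w l) c Hc) x b Hxu Hbc Hxb).
    + apply (sim_obs _ _ _ Hbc); auto.
  - intros w A B HAB Hw. destruct (Phi_closed A B (or_intror HAB)) as [HA HB].
    destruct (lab_not_rhd _ _ K_coh (proj1_sig w) A B HAB Hw) as (j & a & Ha & HaA & Hb).
    destruct (Hl a) as (c & Hc & Hac).
    exists j, (exist (fun w => In w l) c Hc). split; [exists a; auto|]. split.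
    + apply (sim_obs _ _ _ Hac); auto.
    + intros b (x & Hx & Hxb) HbB. apply (Hb x Hx), (sim_obs _ _ _ Hxb); auto.
Qed.

Lemma finitary_model_of_bounded (C : form) (w : pos K) : In C Phi ->
  exists (F : frame) (L : theories F) (x : world F),
    finitary F L /\ (sat F L x C <-> lab w C).
Proof.
  intros HC. destruct (sim_finite_index N) as [l Hl].
  destruct (Hl w) as (u & Hu & Hwu).
  destruct (Finite_sig _ (fun w => In w l) l (fun w Hw => Hw)) as [Ws HWs].
  destruct (finitary_model_of_coherent Phi (quotient l) Phi_closed
              (quotient_coherent l Hl) Js Ws) with (root := exist (fun w => In w l) u Hu)
              (C := C) as (F & L & x & HF & Hx).
  - intros j x y (z & Hz & _). exact (in_Js _ _ _ Hz).
  - exact HWs.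
  - exact HC.
  - exists F, L, x. split; [exact HF|]. rewrite Hx. simpl. symmetry.
    apply (sim_obs _ _ _ Hwu). auto.
Qed.

End Quotient.

(** * Maximal consistent sets *)

Ltac taut :=
  let s := fresh "s" in
  intro s; unfold Dia, Box, Or, And, Neg; cbn [beval];
  repeat match goal with
         | |- context [beval s ?X] => destruct (beval s X)
         | |- context [s ?X] => destruct (s X)
         end; reflexivity.

(** * Derived rules of [ILM] *)

Lemma ilm_mp (A B : form) :
  derives ILM A -> derives ILM (Imp A B) -> derives ILM B.
Proof. apply derives_mp. intros ps C H. exact H. Qed.

Lemma ilm_gl (A : form) : GL_axiom A -> derives ILM A.
Proof. intros H. apply der_axiom, ILM_GL, der_axiom, H. Qed.

Lemma ilm_taut (A : form) : tautology A -> derives ILM A.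
Proof. intros H. apply ilm_gl, GL_taut, H. Qed.

Lemma ilm_scheme (A : form) : ILM_scheme A -> derives ILM A.
Proof. intros H. apply der_axiom, ILM_sch, H. Qed.

Lemma ilm_taut1 (A B : form) :
  derives ILM A -> tautology (Imp A B) -> derives ILM B.
Proof. intros HA H. exact (ilm_mp _ _ HA (ilm_taut _ H)). Qed.

Lemma ilm_taut2 (A B C : form) : derives ILM A -> derives ILM B ->
  tautology (Imp A (Imp B C)) -> derives ILM C.
Proof. intros HA HB H. exact (ilm_mp _ _ HB (ilm_taut1 _ _ HA H)). Qed.

Lemma ilm_taut3 (A B C D : form) :
  derives ILM A -> derives ILM B -> derives ILM C ->
  tautology (Imp A (Imp B (Imp C D))) -> derives ILM D.
Proof. intros HA HB HC H. exact (ilm_mp _ _ HC (ilm_taut2 _ _ _ HA HB H)). Qed.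

(** Modus ponens is the only rule, but the axioms come with their boxes, either through [GL] or as
    [ILM_box], and [GL_K] carries boxes through modus ponens. *)
Lemma ilm_nec (A : form) : derives ILM A -> derives ILM (Box A).
Proof.
  induction 1 as [A HA | ps A Hr _ IH].
  - destruct HA as [A HA | A HA | A HA].
    + apply der_axiom, ILM_GL. apply (der_rule GL [A]); [right; constructor|].
      intros B [<- | []]. exact HA.
    + apply der_axiom, ILM_box, HA.
    + apply (ilm_mp (Box A)); [apply der_axiom, ILM_box, HA | apply ilm_gl, GL_4].
  - destruct Hr as [A B]. apply (ilm_mp (Box A)); [apply IH; simpl; auto|].
    apply (ilm_mp (Box (Imp A B))); [apply IH; simpl; auto | apply ilm_gl, GL_K].
Qed.

Lemma ilm_box_mono (A B : form) :
  derives ILM (Imp A B) -> derives ILM (Imp (Box A) (Box B)).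
Proof. intros H. exact (ilm_mp _ _ (ilm_nec _ H) (ilm_gl _ (GL_K A B))). Qed.

Lemma ilm_box_mono2 (A B C : form) : derives ILM (Imp A (Imp B C)) ->
  derives ILM (Imp (Box A) (Imp (Box B) (Box C))).
Proof.
  intros H. apply (ilm_taut2 _ _ _ (ilm_box_mono _ _ H) (ilm_gl _ (GL_K B C))). taut.
Qed.

(** * Entailment and Lindenbaum's lemma *)

Definition entails (G : form -> Prop) (A : form) : Prop :=
  exists l, (forall B, In B l -> G B) /\ derives ILM (fold_right Imp A l).

Lemma beval_fold_imp (s : form -> bool) (A : form) (l : list form) :
  beval s (fold_right Imp A l) = true <->
  ((forall B, In B l -> beval s B = true) -> beval s A = true).
Proof.
  induction l as [|B l IH]; simpl.
  - split; [auto | intros H; apply H; intros B []].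
  - destruct (beval s B) eqn:EB; simpl.
    + rewrite IH. split; intros H H'; apply H.
      * intros C HC. apply H'. right. exact HC.
      * intros C [<- | HC]; auto.
    + split; [|reflexivity]. intros _ H. rewrite (H B (or_introl eq_refl)) in EB.
      discriminate.
Qed.

Lemma entails_in (G : form -> Prop) (A : form) : G A -> entails G A.
Proof.
  intros H. exists [A]. split; [intros B [<- | []]; exact H|]. apply ilm_taut. simpl. taut.
Qed.

Lemma entails_ilm (G : form -> Prop) (A : form) : derives ILM A -> entails G A.
Proof. intros H. exists []. split; [intros B [] | exact H]. Qed.

Lemma entails_mp (G : form -> Prop) (A B : form) :
  entails G A -> entails G (Imp A B) -> entails G B.
Proof.
  intros (l1 & H1 & D1) (l2 & H2 & D2). exists (l1 ++ l2). split.
  - intros C HC. apply in_app_or in HC. destruct HC; auto.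
  - apply (ilm_taut2 _ _ _ D1 D2). intros s. cbn [beval].
    destruct (beval s (fold_right Imp A l1)) eqn:E1; [|reflexivity].
    destruct (beval s (fold_right Imp (Imp A B) l2)) eqn:E2; [|reflexivity].
    cbn. apply beval_fold_imp. intros H.
    rewrite beval_fold_imp in E1, E2. cbn in E2.
    rewrite E1 in E2; [apply E2|]; intros C HC; apply H, in_or_app; auto.
Qed.

Lemma entails_deduction (G : form -> Prop) (A B : form) :
  entails (fun X => G X \/ X = A) B -> entails G (Imp A B).
Proof.
  intros (l & Hl & D).
  destruct (list_comprehension _ G l) as [l' Hl'].
  exists l'. split; [intros C HC; apply Hl', HC|].
  apply (ilm_taut1 _ _ D). intros s. cbn [beval].
  destruct (beval s (fold_right Imp B l)) eqn:E; [|reflexivity].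
  cbn. apply beval_fold_imp. intros H. cbn. rewrite beval_fold_imp in E.
  destruct (beval s A) eqn:EA; [|reflexivity]. cbn. apply E.
  intros C HC. destruct (Hl C HC) as [HG | ->]; [|exact EA].
  apply H, Hl'. auto.
Qed.

Lemma entails_mono (G G' : form -> Prop) (A : form) :
  (forall B, G B -> G' B) -> entails G A -> entails G' A.
Proof. intros H (l & Hl & D). exists l. auto. Qed.

Definition consistent (G : form -> Prop) : Prop := ~ entails G Bot.

Definition mcs (G : form -> Prop) : Prop :=
  consistent G /\ forall A, G A \/ G (Neg A).

Fixpoint code (A : form) : nat :=
  match A with
  | Atom p => to_nat (0, p)
  | Bot => to_nat (1, 0)
  | Imp A B => to_nat (2, to_nat (code A, code B))
  | Rhd A B => to_nat (3, to_nat (code A, code B))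
  end.

Lemma code_inj (A B : form) : code A = code B -> A = B.
Proof.
  assert (inj : forall x y, to_nat x = to_nat y -> x = y).
  { intros x y H. rewrite <- (cancel_of_to x), <- (cancel_of_to y), H. reflexivity. }
  revert B. induction A as [p | | A1 IH1 A2 IH2 | A1 IH1 A2 IH2];
    intros [q | | B1 B2 | B1 B2] H; cbn [code] in H; apply inj in H;
    try discriminate; try reflexivity; apply (f_equal snd) in H; cbn [snd] in H.
  - subst. reflexivity.
  - apply inj in H. injection H as E1 E2. f_equal; auto.
  - apply inj in H. injection H as E1 E2. f_equal; auto.
Qed.

(** Passing from [n] to [S n] treats the formula with code [n]; by [code_inj] at most one formula is
    added at a time. *)
Fixpoint stage (G : form -> Prop) (n : nat) (B : form) : Prop :=
  match n with
  | 0 => G B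
  | S n => stage G n B \/
      (code B = n /\ consistent (fun X => stage G n X \/ X = B))
  end.

Lemma stage_mono (G : form -> Prop) (m n : nat) (B : form) :
  m <= n -> stage G m B -> stage G n B.
Proof. induction 1; simpl; auto. Qed.

Lemma stage_consistent (G : form -> Prop) (n : nat) :
  consistent G -> consistent (stage G n).
Proof.
  intros HG. induction n as [|n IH]; [exact HG|].
  destruct (classic (exists B, code B = n /\
                       consistent (fun X => stage G n X \/ X = B))) as [(B & HB & HC) | Hn].
  - intros H. apply HC. revert H. apply entails_mono.
    intros X [HX | [HX _]]; [left; exact HX|]. right. apply code_inj. congruence.
  - intros H. apply IH. revert H. apply entails_mono.
    intros X [HX | HX]; [exact HX|]. elim Hn. exists X. exact HX.
Qed.

Lemma lindenbaum (G : form -> Prop) : consistent G ->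
  exists M, mcs M /\ forall A, G A -> M A.
Proof.
  intros HG. exists (fun A => exists n, stage G n A).
  assert (compact : forall A, entails (fun A => exists n, stage G n A) A ->
                              exists n, entails (stage G n) A).
  { intros A (l & Hl & D).
    enough (H : exists n, forall B, In B l -> stage G n B).
    { destruct H as [n Hn]. exists n, l. auto. }
    clear D. induction l as [|B l IH]; [exists 0; intros B []|].
    destruct IH as [n Hn]; [intros C HC; apply Hl; right; exact HC|].
    destruct (Hl B (or_introl eq_refl)) as [m Hm].
    exists (max n m). intros C [<- | HC].
    - apply (stage_mono G m); [lia | exact Hm].
    - apply (stage_mono G n); [lia | auto]. }
  assert (decide : forall A, (exists n, stage G n A) \/ exists n, entails (stage G n) (Neg A)).
  { intros A.
    destruct (classic (consistent (fun X => stage G (code A) X \/ X = A))) as [Hc | Hc].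
    - left. exists (S (code A)). right. auto.
    - right. exists (code A). apply entails_deduction, NNPP, Hc. }
  split; [split|].
  - intros H. destruct (compact _ H) as [n Hn]. exact (stage_consistent G n HG Hn).
  - intros A. destruct (decide A) as [HA | [n Hn]]; [left; exact HA|].
    (* Otherwise [Neg A] and [Neg (Neg A)] are both entailed at some stage, and the larger of the
       two stages is inconsistent. *)
    destruct (decide (Neg A)) as [HA | [m Hm]]; [right; exact HA|]. exfalso.
    apply (stage_consistent G (max n m) HG). apply (entails_mp _ (Neg A)).
    + revert Hn. apply entails_mono. intros B. apply stage_mono. lia.
    + revert Hm. apply entails_mono. intros B. apply stage_mono. lia.
  - intros A HA. exists 0. exact HA.
Qed.

(** * Closure properties of maximal consistent sets *)

Section Mcs.
Context (M : form -> Prop) (HM : mcs M).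

Lemma mcs_entails (A : form) : entails M A -> M A.
Proof.
  intros H. destruct (proj2 HM A) as [HA | HA]; [exact HA|].
  elim (proj1 HM). exact (entails_mp _ _ _ H (entails_in _ _ HA)).
Qed.

Lemma mcs_ilm (A : form) : derives ILM A -> M A.
Proof. intros H. apply mcs_entails, entails_ilm, H. Qed.

Lemma mcs_mp (A B : form) : M A -> M (Imp A B) -> M B.
Proof.
  intros HA HAB. apply mcs_entails, (entails_mp _ A); apply entails_in; assumption.
Qed.

Lemma mcs_ilm_mp (A B : form) : derives ILM (Imp A B) -> M A -> M B.
Proof. intros H HA. exact (mcs_mp _ _ HA (mcs_ilm _ H)). Qed.

Lemma mcs_bot : ~ M Bot.
Proof. intros H. exact (proj1 HM (entails_in _ _ H)). Qed.

Lemma mcs_neg (A : form) : M (Neg A) <-> ~ M A.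
Proof.
  split.
  - intros H HA. exact (mcs_bot (mcs_mp _ _ HA H)).
  - intros H. destruct (proj2 HM A); tauto.
Qed.

Lemma mcs_imp (A B : form) : M (Imp A B) <-> (M A -> M B).
Proof.
  split; [intros H HA; exact (mcs_mp _ _ HA H)|]. intros H.
  destruct (proj2 HM A) as [HA | HA].
  - apply (mcs_ilm_mp B); [apply ilm_taut; taut | auto].
  - apply (mcs_ilm_mp (Neg A)); [apply ilm_taut; taut | auto].
Qed.

Lemma mcs_and (A B : form) : M (And A B) <-> M A /\ M B.
Proof. unfold And. rewrite mcs_neg, mcs_imp, mcs_neg. tauto. Qed.

Lemma mcs_rhd_of_imp (A B : form) : derives ILM (Imp A B) -> M (Rhd A B).
Proof.
  intros H. apply mcs_ilm, (ilm_mp _ _ (ilm_nec _ H)), ilm_scheme, ILM_J1.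
Qed.

Lemma mcs_rhd_trans (A B C : form) : M (Rhd A B) -> M (Rhd B C) -> M (Rhd A C).
Proof.
  intros H1 H2. apply (mcs_mp (And (Rhd A B) (Rhd B C))).
  - apply mcs_and. auto.
  - apply mcs_ilm, ilm_scheme, ILM_J2.
Qed.

Lemma mcs_rhd_or (A B C : form) : M (Rhd A C) -> M (Rhd B C) -> M (Rhd (Or A B) C).
Proof.
  intros H1 H2. apply (mcs_mp (And (Rhd A C) (Rhd B C))).
  - apply mcs_and. auto.
  - apply mcs_ilm, ilm_scheme, ILM_J3.
Qed.

Lemma mcs_rhd_or_dia (A : form) : M (Rhd (Or A (Dia A)) A).
Proof.
  apply mcs_rhd_or.
  - apply mcs_rhd_of_imp, ilm_taut. taut.
  - apply mcs_ilm, ilm_scheme, ILM_J5.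
Qed.

Lemma mcs_rhd_mono (A A' B : form) :
  derives ILM (Imp A A') -> M (Rhd A' B) -> M (Rhd A B).
Proof. intros H. apply mcs_rhd_trans, mcs_rhd_of_imp, H. Qed.

Lemma mcs_montagna (A B C : form) :
  M (Rhd A B) -> M (Rhd (And (Box C) A) (And (Box C) B)).
Proof. intros H. apply (mcs_mp _ _ H), mcs_ilm, ilm_scheme, ILM_M. Qed.

(** By the axiom of Löb, [A] implies [Or Y (Dia Y)] for the target formula [Y], and J3 with J5
    absorbs the diamond. *)
Lemma mcs_rhd_minimal (A : form) : M (Rhd A (And A (Box (Neg A)))).
Proof.
  set (Y := And A (Box (Neg A))).
  apply (mcs_rhd_trans _ (Or Y (Dia Y))); [|apply mcs_rhd_or_dia].
  apply mcs_rhd_of_imp.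
  assert (H : derives ILM (Imp (Box (Neg Y)) (Box (Imp (Box (Neg A)) (Neg A))))).
  { apply ilm_box_mono, ilm_taut. unfold Y. taut. }
  apply (ilm_taut2 _ _ _ H (ilm_gl _ (GL_Lob (Neg A)))). unfold Y. taut.
Qed.

End Mcs.

(** * Critical successors *)

Definition critical (C : form) (M N : form -> Prop) : Prop :=
  forall G, M (Rhd G C) -> N (Neg G) /\ N (Box (Neg G)).

(** [Box A] unfolds to [Rhd (Neg A) Bot], which gives [Rhd (Neg A) C] for every [C]. So critical
    successors of any label respect boxes. *)
Lemma critical_box (C A : form) (M N : form -> Prop) : mcs M -> mcs N ->
  critical C M N -> M (Box A) -> N A /\ N (Box A).
Proof.
  intros HM HN H HA. destruct (H (Neg A)) as [H1 H2].
  - apply (mcs_rhd_trans M HM _ Bot); [exact HA|].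
    apply mcs_rhd_of_imp, ilm_taut; [exact HM | taut].
  - split.
    + apply (mcs_ilm_mp N HN (Neg (Neg A))); [apply ilm_taut; taut | exact H1].
    + apply (mcs_ilm_mp N HN (Box (Neg (Neg A)))); [|exact H2].
      apply ilm_box_mono, ilm_taut. taut.
Qed.

(** [Sg] prescribes boxes the successor has to contain: boxes of theorems in [critical_successor],
    those of another successor in [critical_transfer]. The member [Box (Neg B)] ensures that the
    step gains a box. *)
Definition critical_seed (M : form -> Prop) (C B : form) (Sg : form -> Prop)
    (X : form) : Prop :=
  (exists G, M (Rhd G C) /\ (X = Neg G \/ X = Box (Neg G))) \/
  X = B \/ X = Box (Neg B) \/ exists E, Sg E /\ X = Box E.

Definition seed_conj (B G E : form) : form :=
  And (Box E) (And B (And (Box (Neg B)) (And (Neg G) (Box (Neg G))))).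

Lemma seed_conj_mono (B G G' E E' : form) :
  derives ILM (Imp G G') -> derives ILM (Imp E' E) ->
  derives ILM (Imp (seed_conj B G' E') (seed_conj B G E)).
Proof.
  intros HG HE.
  assert (HG' : derives ILM (Imp (Box (Neg G')) (Box (Neg G)))).
  { apply ilm_box_mono, (ilm_taut1 _ _ HG). taut. }
  apply (ilm_taut3 _ _ _ _ HG HG' (ilm_box_mono _ _ HE)). unfold seed_conj. taut.
Qed.

(** Finitely many members of the seed follow from one conjunction: the formulas [G] are merged by
    [Or], using J3, and the formulas [E] by [And]. *)
Lemma seed_conj_bound (M : form -> Prop) (C B : form) (Sg : form -> Prop)
    (l : list form) :
  mcs M -> Sg (Neg Bot) -> (forall E E', Sg E -> Sg E' -> Sg (And E E')) ->
  (forall X, In X l -> critical_seed M C B Sg X) ->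
  exists G E, M (Rhd G C) /\ Sg E /\
    forall X, In X l -> derives ILM (Imp (seed_conj B G E) X).
Proof.
  intros HM Sg_top Sg_and. induction l as [|X l IH]; intros Hl.
  - exists Bot, (Neg Bot). split; [|split; [exact Sg_top | intros X []]].
    apply mcs_rhd_of_imp, ilm_taut; [exact HM | taut].
  - destruct IH as (G & E & HG & HE & H); [intros Y HY; apply Hl; right; exact HY|].
    destruct (Hl X (or_introl eq_refl))
      as [(G' & HG' & HX) | [-> | [-> | (E' & HE' & ->)]]].
    + exists (Or G G'), E. split; [apply mcs_rhd_or; assumption|].
      split; [exact HE|]. intros Y [<- | HY].
      * assert (H' : derives ILM (Imp (seed_conj B (Or G G') E) (seed_conj B G' E))).
        { apply seed_conj_mono; apply ilm_taut; taut. }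
        apply (ilm_taut1 _ _ H'). destruct HX as [-> | ->]; unfold seed_conj; taut.
      * assert (H' : derives ILM (Imp (seed_conj B (Or G G') E) (seed_conj B G E))).
        { apply seed_conj_mono; apply ilm_taut; taut. }
        apply (ilm_taut2 _ _ _ H' (H Y HY)). taut.
    + exists G, E. split; [exact HG|]. split; [exact HE|].
      intros Y [<- | HY]; [apply ilm_taut; unfold seed_conj; taut | auto].
    + exists G, E. split; [exact HG|]. split; [exact HE|].
      intros Y [<- | HY]; [apply ilm_taut; unfold seed_conj; taut | auto].
    + exists G, (And E E'). split; [exact HG|]. split; [auto|].
      intros Y [<- | HY].
      * assert (H' : derives ILM (Imp (seed_conj B G (And E E')) (seed_conj B G E'))).
        { apply seed_conj_mono; apply ilm_taut; taut. }
        apply (ilm_taut1 _ _ H'). unfold seed_conj. taut.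
      * assert (H' : derives ILM (Imp (seed_conj B G (And E E')) (seed_conj B G E))).
        { apply seed_conj_mono; apply ilm_taut; taut. }
        apply (ilm_taut2 _ _ _ H' (H Y HY)). taut.
Qed.

(* If the seed were inconsistent, then [X := Box E /\ B] would satisfy
   [X |> X /\ Box ~X |> G \/ Dia G |> G |> C]. *)
Lemma critical_seed_consistent (M : form -> Prop) (C B : form) (Sg : form -> Prop) :
  mcs M -> Sg (Neg Bot) -> (forall E E', Sg E -> Sg E' -> Sg (And E E')) ->
  (forall E, Sg E -> ~ M (Rhd (And (Box E) B) C)) ->
  consistent (critical_seed M C B Sg).
Proof.
  intros HM Sg_top Sg_and HC (l & Hl & D).
  destruct (seed_conj_bound M C B Sg l HM Sg_top Sg_and Hl) as (G & E & HG & HE & H).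
  apply (HC E HE). set (X := And (Box E) B).
  assert (Hbot : derives ILM (Imp (seed_conj B G E) Bot)).
  { clear Hl.
    assert (D' : derives ILM (Imp (seed_conj B G E) (fold_right Imp Bot l))).
    { apply (ilm_taut1 _ _ D). taut. }
    clear D. induction l as [|Y l IH]; [exact D'|].
    apply IH; [intros Z HZ; apply H; right; exact HZ|].
    apply (ilm_taut2 _ _ _ D' (H Y (or_introl eq_refl))). simpl. taut. }
  (* [Box E] persists to all successors by axiom 4, so refuting [X] there amounts to refuting
     [B]. *)
  assert (HB : derives ILM (Imp (Box E) (Imp (Box (Neg X)) (Box (Neg B))))).
  { assert (H' : derives ILM (Imp (Box (Box E)) (Imp (Box (Neg X)) (Box (Neg B))))).
    { apply ilm_box_mono2, ilm_taut. unfold X. taut. }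
    apply (ilm_taut2 _ _ _ (ilm_gl _ (GL_4 E)) H'). taut. }
  apply (mcs_rhd_trans M HM _ _ _ (mcs_rhd_minimal M HM X)).
  apply (mcs_rhd_mono M HM _ (Or G (Dia G))).
  - apply (ilm_taut2 _ _ _ Hbot HB). unfold X, seed_conj. taut.
  - exact (mcs_rhd_trans M HM _ _ _ (mcs_rhd_or_dia M HM G) HG).
Qed.

Lemma critical_successor (M : form -> Prop) (A C : form) : mcs M ->
  ~ M (Rhd A C) ->
  exists N, mcs N /\ critical C M N /\ N A /\ N (Box (Neg A)).
Proof.
  intros HM HA.
  destruct (lindenbaum (critical_seed M C A (derives ILM))) as (N & HN & Hs).
  - apply critical_seed_consistent; [exact HM | apply ilm_taut; taut | |].
    + intros E E' HE HE'. apply (ilm_taut2 _ _ _ HE HE'). taut.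
    + intros E HE H. apply HA, (mcs_rhd_mono M HM _ (And (Box E) A)); [|exact H].
      apply (ilm_taut1 _ _ (ilm_nec _ HE)). taut.
  - exists N. split; [exact HN|]. split.
    + intros G HG. split; apply Hs; left; exists G; auto.
    + split; apply Hs; right; auto.
Qed.

(** If [M] contained [Box E /\ B |> C] for some [Box E] in [N], then Montagna's axiom would give
    [Box E /\ A |> C], and criticality would keep [Box E /\ A] out of [N]. *)
Lemma critical_transfer (M N : form -> Prop) (A B C : form) : mcs M -> mcs N ->
  M (Rhd A B) -> critical C M N -> N A ->
  exists N', mcs N' /\ critical C M N' /\ N' B /\ N' (Box (Neg B)) /\
    forall E, N (Box E) -> N' (Box E).
Proof.
  intros HM HN HAB HMN HA.
  destruct (lindenbaum (critical_seed M C B (fun E => N (Box E)))) as (N' & HN' & Hs).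
  - apply critical_seed_consistent; [exact HM | | |].
    + apply (mcs_ilm N HN), ilm_nec, ilm_taut. taut.
    + intros E E' HE HE'. apply (mcs_mp N HN (Box E')); [exact HE'|].
      apply (mcs_ilm_mp N HN (Box E)); [|exact HE].
      apply ilm_box_mono2, ilm_taut. taut.
    + intros E HE H.
      destruct (HMN (And (Box E) A)) as [Hn _].
      * exact (mcs_rhd_trans M HM _ _ _ (mcs_montagna M HM A B E HAB) H).
      * apply (mcs_neg N HN) in Hn. apply Hn, (mcs_and N HN). auto.
  - exists N'. split; [exact HN'|]. split; [|repeat split].
    + intros G HG. split; apply Hs; left; exists G; auto.
    + apply Hs. right. auto.
    + apply Hs. right. auto.
    + intros E HE. apply Hs. right. right. right. exists E. auto.
Qed.

(** * The canonical structure *)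

Section Canonical.
Context (Phi : list form) (Phi_closed : sub_closed Phi).

Definition rhd_args : list form :=
  flat_map (fun X => match X with Rhd A B => [A; B] | _ => [] end) Phi.

Lemma in_rhd_args (A B : form) :
  In (Rhd A B) Phi -> In A rhd_args /\ In B rhd_args.
Proof.
  intros H. split; apply in_flat_map; exists (Rhd A B); simpl; auto.
Qed.

Definition new_box (M N : form -> Prop) : Prop :=
  exists D, In D rhd_args /\ ~ M (Box (Neg D)) /\ N (Box (Neg D)).

Definition missing_boxes (M : form -> Prop) : list form :=
  filter (fun D => if excluded_middle_informative (M (Box (Neg D)))
                   then false else true) rhd_args.

Definition canonical : lts :=
  Lts {M | mcs M} form
    (fun C M N => In C (Bot :: rhd_args) /\
       critical C (proj1_sig M) (proj1_sig N) /\ new_box (proj1_sig M) (proj1_sig N))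
    (fun M => proj1_sig M)
    (fun M => length (missing_boxes (proj1_sig M))).

(** The gained box is [Box (Neg A)]: had [M] contained it, [N] would contain [Neg A]. *)
Lemma new_box_of (M N : form -> Prop) (A C : form) : mcs M -> mcs N ->
  critical C M N -> In A rhd_args -> N A -> N (Box (Neg A)) -> new_box M N.
Proof.
  intros HM HN HMN HA NA NbA. exists A. repeat split; auto. intros MA.
  destruct (critical_box C (Neg A) M N HM HN HMN MA) as [H _].
  exact (proj1 (mcs_neg N HN A) H NA).
Qed.

(** A step from [N] can be replaced by one from [M] with label [Bot]: [G |> Bot] amounts to
    [Box (Neg G)], so being [Bot]-critical asks only that boxes be respected. *)
Lemma canonical_below (M N : pos canonical) :
  (forall E, lab M (Box E) -> lab N (Box E)) -> below M N.
Proof.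
  destruct M as [M HM], N as [N HN]. simpl. intros H [Z HZ] (C & _ & HC & D & HD & ND & ZD).
  simpl in *. exists Bot. split; [left; reflexivity|]. simpl. split.
  - intros G HG. apply (critical_box C (Neg G) N Z HN HZ HC). apply H.
    apply (mcs_rhd_mono M HM _ G); [apply ilm_taut; taut | exact HG].
  - exists D. split; [exact HD|]. split; [|exact ZD].
    intros MD. exact (ND (H _ MD)).
Qed.

Lemma canonical_coherent : coherent Phi canonical.
Proof.
  split.
  - intros C C' [M HM] [N HN] [Z HZ] (HC & HMN & D & HD & MD & ND) (_ & HNZ & _).
    simpl in *. split; [exact HC|]. split.
    (* [Box (Neg G)] passes from [N] to its critical successors of any label, so [Z] is still
       critical for the first label. *)
    + intros G HG. exact (critical_box C' (Neg G) N Z HN HZ HNZ (proj2 (HMN G HG))).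
    + exists D. repeat split; auto.
      exact (proj2 (critical_box C' (Neg D) N Z HN HZ HNZ ND)).
  - intros C [M HM] [N HN] (_ & HMN & D & HD & MD & ND). simpl in *.
    (* Boxes persist along steps, and the box gained for [D] makes the count of missing ones
       drop. *)
    apply (filter_length_lt _ _ _ _ D); [|exact HD| |].
    + intros E.
      destruct (excluded_middle_informative (M (Box (Neg E)))) as [ME | ME];
      destruct (excluded_middle_informative (N (Box (Neg E)))) as [NE | NE]; auto.
      elim NE. exact (proj2 (critical_box C (Neg E) M N HM HN HMN ME)).
    + destruct excluded_middle_informative; tauto.
    + destruct excluded_middle_informative; tauto.
  - intros [M HM]. exact (mcs_bot M HM).
  - intros [M HM] A B _. exact (mcs_imp M HM A B).
  - intros [M HM] [N HN] C A B HAB MAB (HC & HMN & _) NA. simpl in *.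
    destruct (critical_transfer M N A B C HM HN MAB HMN NA)
      as (N' & HN' & HMN' & NB & NbB & Hbox).
    exists (exist _ N' HN'). split; [|split].
    + split; [exact HC|]. split; [exact HMN'|].
      exact (new_box_of M N' B C HM HN' HMN' (proj2 (in_rhd_args A B HAB)) NB NbB).
    + apply canonical_below, Hbox.
    + exact NB.
  - intros [M HM] A B HAB MAB. simpl in *.
    destruct (critical_successor M A B HM MAB) as (N & HN & HMN & NA & NbA).
    destruct (in_rhd_args A B HAB) as [HA HB].
    (* The label is the consequent itself: as [B |> B] is in [M], every [B]-critical successor
       contains [Neg B]. *)
    exists B, (exist _ N HN). split; [|split; [exact NA|]].
    + split; [right; exact HB|]. split; [exact HMN|].
      exact (new_box_of M N A B HM HN HMN HA NA NbA).
    + intros [Z HZ] (_ & HMZ & _) ZB. simpl in *.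
      destruct (HMZ B) as [H _]; [apply mcs_rhd_of_imp, ilm_taut; [exact HM | taut]|].
      exact (proj1 (mcs_neg Z HZ B) H ZB).
Qed.

(** Besides [Phi], the boxes counted by the rank are observed, so that points agreeing on all
    observations have equal rank. *)
Lemma finitary_model_of_mcs (M : form -> Prop) (C : form) : mcs M -> In C Phi ->
  exists (F : frame) (L : theories F) (x : world F),
    finitary F L /\ (sat F L x C <-> M C).
Proof.
  intros HM HC.
  apply (finitary_model_of_bounded Phi
           (Phi ++ map (fun D => Box (Neg D)) rhd_args) canonical Phi_closed
           canonical_coherent (incl_appl _ (incl_refl _)) (Bot :: rhd_args)
           (fun j w u H => proj1 H))
    with (N := length rhd_args) (w := exist _ M HM); [| |exact HC].
  - intros [M1 H1] [M2 H2] H. simpl in *. unfold missing_boxes. f_equal.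
    apply filter_ext_in. intros D HD.
    assert (E : M1 (Box (Neg D)) <-> M2 (Box (Neg D))).
    { apply H, in_or_app. right. apply (in_map (fun D => Box (Neg D))), HD. }
    destruct (excluded_middle_informative (M1 (Box (Neg D)))),
             (excluded_middle_informative (M2 (Box (Neg D)))); tauto.
  - intros [M1 H1]. apply filter_length_le.
Qed.

End Canonical.

(** * Subformulas and the completeness theorem *)

Fixpoint subformulas (A : form) : list form :=
  A :: match A with
       | Imp B C | Rhd B C => subformulas B ++ subformulas C
       | _ => []
       end.

Lemma subformulas_self (A : form) : In A (subformulas A).
Proof. destruct A; left; reflexivity. Qed.

Lemma subformulas_closed (A : form) : sub_closed (subformulas A).
Proof.
  induction A as [p | | A IHA B IHB | A IHA B IHB]; intros X Y H; simpl in *.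
  - destruct H as [[H | []] | [H | []]]; discriminate.
  - destruct H as [[H | []] | [H | []]]; discriminate.
  - assert (H' : (X = A /\ Y = B) \/
      (In (Imp X Y) (subformulas A) \/ In (Rhd X Y) (subformulas A)) \/
      (In (Imp X Y) (subformulas B) \/ In (Rhd X Y) (subformulas B))).
    { rewrite !in_app_iff in H.
      destruct H as [[H | H] | [H | H]]; [injection H as <- <- | | discriminate |]; tauto. }
    rewrite !in_app_iff. destruct H' as [[-> ->] | [H' | H']].
    + split; right; [left | right]; apply subformulas_self.
    + apply IHA in H'. tauto.
    + apply IHB in H'. tauto.
  - assert (H' : (X = A /\ Y = B) \/
      (In (Imp X Y) (subformulas A) \/ In (Rhd X Y) (subformulas A)) \/
      (In (Imp X Y) (subformulas B) \/ In (Rhd X Y) (subformulas B))).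
    { rewrite !in_app_iff in H.
      destruct H as [[H | H] | [H | H]]; [discriminate | | injection H as <- <- |]; tauto. }
    rewrite !in_app_iff. destruct H' as [[-> ->] | [H' | H']].
    + split; right; [left | right]; apply subformulas_self.
    + apply IHA in H'. tauto.
    + apply IHB in H'. tauto.
Qed.

Theorem theorem5p12 (A : form)
    (hA : forall (F : frame) (L : theories F),
        finitary F L -> forall w : world F, sat F L w A) :
  derives ILM A.
Proof.
  apply NNPP. intros Hn.
  (* The disjunct [False] is the empty premise set in the form expected by [entails_deduction];
     inconsistency would make [Neg (Neg A)] a theorem. *)
  destruct (lindenbaum (fun X => False \/ X = Neg A)) as (M & HM & HMA).
  - intros H. apply entails_deduction in H. destruct H as (l & Hl & D).
    destruct l as [|B l]; [|elim (Hl B (or_introl eq_refl))].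
    apply Hn, (ilm_taut1 _ _ D). simpl. taut.
  - destruct (finitary_model_of_mcs (subformulas A) (subformulas_closed A) M A HM
                (subformulas_self A)) as (F & L & x & HF & Hx).
    apply (proj1 (mcs_neg M HM A)); [apply HMA; right; reflexivity|].
    apply Hx, hA, HF.
Qed.
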